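(* Let $t\in[0,1]$ and let $A, B \in \mathbb{P}_m$ be $m\times m$ positive definite Hermitian matrices such that for any $0 < p \leq q \leq 1$ $$ (A^{-p} \# B^{p})^{1/p} \leq (A^{-q} \# B^{q})^{1/q}. $$ Then $(A^p \diamond_t B^p)^{1/p}$ converges decreasingly, with respect to the weak log-majorization $\prec_{w\log}$, to $\exp((1-t)\log A + t\log B)$ as $p\searrow 0$; that is, $$ (A^p\diamond_t B^p)^{1/p}\prec_{w\log}(A^q\diamond_t B^q)^{1/q}\quad\text{for all } 0<p\le q\le 1, $$ and $$ \lim_{p\to 0^+}(A^p\diamond_t B^p)^{1/p}=\exp((1-t)\log A+t\log B). $$
   Context: $\mathbb{P}_m$ is the set of $m\times m$ complex positive definite Hermitian matrices; real powers, $\log$ and $\exp$ are taken by functional calculus; $\le$ between matrices is the Loewner order ($X\le Y$ iff $Y-X$ is positive semidefinite). Write $A\# B=A^{1/2}(A^{-1/2}BA^{-1/2})^{1/2}A^{1/2}$ for the metric geometric mean. The two-variable Wasserstein mean is $A\diamond_t B=(1-t)^2A+t^2B+t(1-t)\left[A(A^{-1}\# B)+(A^{-1}\# B)A\right]$, which equals $\left[(1-t)I+t(A^{-1}\# B)\right]A\left[(1-t)I+t(A^{-1}\# B)\right]$. For $X,Y\in\mathbb{P}_m$ with eigenvalues listed in non-increasing order, $X\prec_{w\log}Y$ (weak log-majorization) means $\prod_{i=1}^k\lambda_i(X)\le\prod_{i=1}^k\lambda_i(Y)$ for all $k=1,\dots,m$. *)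

(* Defs.v *)
From HB Require Import structures.
From mathcomp Require Import all_boot all_order all_algebra.
From mathcomp Require Import spectral complex.
From mathcomp Require Import all_classical all_reals all_analysis.

Set Implicit Arguments.
Unset Strict Implicit.
Unset Printing Implicit Defensive.

Import Order.TTheory GRing.Theory Num.Theory.
Import numFieldNormedType.Exports.

Local Open Scope ring_scope.
Local Open Scope complex_scope.
Local Open Scope sesquilinear_scope.

(* Topology of R[i]: the one of the modulus, i.e. the one any numFieldType gets
   from its norm. 'M[R[i]]_m then carries the entrywise topology. *)
HB.instance Definition _ (R : rcfType) :=
  PseudoPointedMetric.copy R[i] (R[i] : numClosedFieldType).

Section PositiveDefiniteMatrices.
Variables (R : realType) (m : nat).
Implicit Types (A B X Y : 'M[R[i]]_m).

(* The order on R[i] is the partial one: 0 <= z iff z is real and nonnegative. *)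
Definition psdmx A : Prop :=
  A \is hermsymmx /\ forall v : 'cV[R[i]]_m, 0 <= (v ^t* *m A *m v) 0 0.

Definition pdmx A : Prop :=
  A \is hermsymmx /\
  forall v : 'cV[R[i]]_m, v != 0 -> 0 < (v ^t* *m A *m v) 0 0.

Definition loewner_le X Y : Prop := psdmx (Y - X).

(* Functional calculus: meaningful for Hermitian A only, in which case the
   entries of spectral_diag A are the (real) eigenvalues of A, repeated
   according to multiplicity (see orthomx_spectralP). *)
Definition mxfun (f : R -> R) A : 'M[R[i]]_m :=
  invmx (spectralmx A)
  *m diag_mx (map_mx (fun z : R[i] => (f (complex.Re z))%:C) (spectral_diag A))
  *m spectralmx A.

Definition mxpow A (p : R) : 'M[R[i]]_m := mxfun (fun x => x `^ p) A.
Definition mxlog A : 'M[R[i]]_m := mxfun (@ln R) A.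
Definition mxexp A : 'M[R[i]]_m := mxfun (@expR R) A.

Definition gmean A B : 'M[R[i]]_m :=
  mxpow A 2^-1
  *m mxpow (mxpow A (- 2^-1) *m B *m mxpow A (- 2^-1)) 2^-1
  *m mxpow A 2^-1.

Definition wmean (t : R) A B : 'M[R[i]]_m :=
  ((1 - t) ^+ 2)%:C *: A + (t ^+ 2)%:C *: B
  + (t * (1 - t))%:C *:
      (A *m gmean (invmx A) B + gmean (invmx A) B *m A).

(* Eigenvalues of a Hermitian matrix, with multiplicity, non-increasing. *)
Definition eigenvalues X : seq R :=
  sort (fun x y : R => y <= x)
    [seq complex.Re (spectral_diag X 0 i) | i <- enum 'I_m].

Definition wlogmaj X Y : Prop :=
  forall k : nat, (1 <= k <= m)%N ->
    \prod_(i < k) (eigenvalues X)`_i <= \prod_(i < k) (eigenvalues Y)`_i.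

End PositiveDefiniteMatrices.

(* Main.v *)
Require Import Defs.
From HB Require Import structures.
From mathcomp Require Import all_boot all_order all_algebra.
From mathcomp Require Import spectral complex ring.
From mathcomp Require Import all_classical all_reals all_analysis.

Set Implicit Arguments.
Unset Strict Implicit.
Unset Printing Implicit Defensive.

Import Order.TTheory GRing.Theory Num.Theory.
Import numFieldNormedType.Exports.

Local Open Scope classical_set_scope.
Local Open Scope ring_scope.
Local Open Scope complex_scope.

(** At p = 1/2 and q = 1 the hypothesis reads G^2 <= H with
    G = A^(-1/2) # B^(1/2) and H = A^(-1) # B.  These two matrices have the same
    determinant, so G^2 = H.  Writing a = A^(1/2), the Riccati equations
    G a G = B^(1/2) and H A H = B then give G a^2 G = a G^2 a: the matrix G a is
    normal, and it is similar to a Hermitian one, hence Hermitian.  Thus G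
    commutes with a, and A with B.  In a common eigenbasis the p-th mean is the
    weighted power mean of exponent p/2 of the eigenvalues of A and B, which is
    nondecreasing in p and tends to the weighted geometric mean. *)
Local Open Scope sesquilinear_scope.

(** * Hermitian matrices in a unitary eigenbasis: functional calculus and spectrum *)

Section UnitaryDiagonal.
Variables (R : realType) (m : nat).
Implicit Types (A B X Y U V : 'M[R[i]]_m) (d e : 'I_m -> R).

Definition diagc d : 'M[R[i]]_m := diag_mx (\row_i (d i)%:C).

(** The eigenvectors are the adjoints of the rows of [U], which is the convention of [spectralmx].
    The diagonal is real, so for unitary [U] these are exactly the Hermitian matrices, with an
    eigenbasis made explicit. *)
Definition udiag U d : 'M[R[i]]_m := U ^t* *m diagc d *m U.

Lemma conjC_real_complex (x : R) : Num.conj (x%:C : R[i]) = x%:C.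
Proof. by apply: conj_Creal; apply/complex_realP; exists x. Qed.

Lemma diagcE d i j : diagc d i j = (d i)%:C *+ (i == j).
Proof. by rewrite !mxE; case: eqP => [->|_]; rewrite ?mulr1n ?mulr0n. Qed.

Lemma diagcM d e : diagc d *m diagc e = diagc (fun i => d i * e i).
Proof.
rewrite mulmx_diag; congr diag_mx; apply/rowP => i.
by rewrite !mxE rmorphM.
Qed.

Lemma trmxC_diagc d : (diagc d)^t* = diagc d.
Proof.
apply/matrixP => i j; rewrite mxE [in LHS]mxE !diagcE eq_sym.
by case: eqP => [->|_]; rewrite ?mulr1n ?conjC_real_complex // mulr0n conjC0.
Qed.

Lemma trmxC_mul p q r (M : 'M[R[i]]_(p, q)) (N : 'M[R[i]]_(q, r)) :
  (M *m N)^t* = N ^t* *m M ^t*.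
Proof. by rewrite trmx_mul map_mxM. Qed.

Lemma hermsymmxP A : reflect (A ^t* = A) (A \is hermsymmx).
Proof.
apply: (iffP (is_hermitianmxP _ _ _)); rewrite expr0 scale1r.
  by move=> <-.
by move=> ->.
Qed.

Lemma trmxC_unitaryK U : U \is unitarymx -> U ^t* *m U = 1%:M.
Proof. by move=> uU; apply: mulmx1C; apply/unitarymxP. Qed.

Lemma trmxC_udiag U d : (udiag U d)^t* = udiag U d.
Proof. by rewrite !trmxC_mul trmxCK trmxC_diagc mulmxA. Qed.

Lemma udiag_herm U d : udiag U d \is hermsymmx.
Proof. by apply/hermsymmxP; rewrite trmxC_udiag. Qed.

Lemma udiagM U d e : U \is unitarymx ->
  udiag U d *m udiag U e = udiag U (fun i => d i * e i).
Proof.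
by move=> uU; rewrite /udiag -diagcM !mulmxA mulmxtVK.
Qed.

Lemma udiagD U d e : udiag U d + udiag U e = udiag U (fun i => d i + e i).
Proof.
rewrite /udiag.
have -> : diagc (fun i => d i + e i) = diagc d + diagc e.
  by apply/matrixP => i j; rewrite [RHS]mxE !diagcE rmorphD mulrnDl.
by rewrite mulmxDr mulmxDl.
Qed.

Lemma udiagZ U (c : R) d : c%:C *: udiag U d = udiag U (fun i => c * d i).
Proof.
rewrite /udiag.
have -> : diagc (fun i => c * d i) = c%:C *: diagc d.
  by apply/matrixP => i j; rewrite [RHS]mxE !diagcE rmorphM mulrnAr.
by rewrite -scalemxAr -scalemxAl.
Qed.

Lemma eq_udiag U d e : d =1 e -> udiag U d = udiag U e.
Proof. by move=> de; rewrite (funext de). Qed.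

Lemma udiag1 U : U \is unitarymx -> udiag U (fun=> 1) = 1%:M.
Proof.
move=> uU; rewrite -(trmxC_unitaryK uU) /udiag.
suff -> : diagc (fun=> 1) = 1%:M by rewrite mulmx1.
by apply/matrixP => i j; rewrite diagcE mxE.
Qed.

Lemma invmx_udiag U d : U \is unitarymx -> (forall i, d i != 0) ->
  invmx (udiag U d) = udiag U (fun i => (d i)^-1).
Proof.
move=> uU d0.
have dV : udiag U d *m udiag U (fun i => (d i)^-1) = 1%:M.
  by rewrite udiagM// -(udiag1 uU); apply: eq_udiag => i; rewrite divff.
have [du _] := mulmx1_unit dV.
by rewrite -[RHS]mul1mx -(mulVmx du) -mulmxA dV mulmx1.
Qed.

Lemma det_udiag U d : U \is unitarymx -> \det (udiag U d) = (\prod_i d i)%:C.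
Proof.
move=> uU; rewrite /udiag !det_mulmx mulrC mulrA -det_mulmx.
have /unitarymxP -> := uU; rewrite det1 mul1r det_diag rmorph_prod.
by apply: eq_bigr => i _; rewrite mxE.
Qed.

(** Entrywise the premise reads s_i W_ij = W_ij d_j: wherever W_ij is nonzero, s_i = d_j and the two
    values of [f] agree. *)
Lemma diagc_intertwine (W : 'M[R[i]]_m) (f : R -> R) d (s : 'rV[R[i]]_m) :
  diag_mx s *m W = W *m diagc d ->
  diag_mx (map_mx (fun z : R[i] => (f (complex.Re z))%:C) s) *m W
  = W *m diagc (f \o d).
Proof.
move=> sW; apply/matrixP => i j; rewrite mul_diag_mx mul_mx_diag !mxE.
have /matrixP/(_ i j) := sW; rewrite mul_diag_mx mul_mx_diag !mxE.
have [->|Wij] := eqVneq (W i j) 0; first by rewrite !mulr0 !mul0r.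
by rewrite mulrC => /(mulfI Wij) ->; rewrite mulrC.
Qed.

Lemma hermsymmx_spectralE A : A \is hermsymmx ->
  A = (spectralmx A)^t* *m diag_mx (spectral_diag A) *m spectralmx A.
Proof.
move=> /hermitian_normalmx/orthomx_spectralP {1}->.
by rewrite (invmx_unitary (spectral_unitarymx _)).
Qed.

(* Independence of the functional calculus from the chosen diagonalization: the
   transition matrix between two eigenbases only links equal eigenvalues. *)
Lemma mxfun_udiag (f : R -> R) U d : U \is unitarymx ->
  mxfun f (udiag U d) = udiag U (f \o d).
Proof.
move=> uU; rewrite /mxfun (invmx_unitary (spectral_unitarymx _)).
set A := udiag U d; set S := spectralmx A; set s := spectral_diag A.
have uS : S \is unitarymx := spectral_unitarymx A.
have /unitarymxP SSt := uS; have /unitarymxP UUt := uU.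
have sW : diag_mx s *m (S *m U ^t*) = S *m U ^t* *m diagc d.
  have : S *m A *m U ^t* = diag_mx s *m (S *m U ^t*).
    rewrite {1}(hermsymmx_spectralE (udiag_herm U d : A \is hermsymmx)) -/S -/s.
    by rewrite !mulmxA SSt mul1mx.
  move=> <-; rewrite /A /udiag -!mulmxA; congr (_ *m (_ *m _)).
  by rewrite UUt mulmx1.
have := diagc_intertwine f sW; set E := diag_mx _ => EW.
have -> : udiag U (f \o d) = S^t* *m (S *m U ^t* *m diagc (f \o d)) *m U.
  by rewrite !mulmxA (trmxC_unitaryK uS) mul1mx.
by rewrite -EW -!mulmxA (trmxC_unitaryK uU) mulmx1.
Qed.

Lemma hermsymmx_udiag A : A \is hermsymmx ->
  exists U d, U \is unitarymx /\ A = udiag U d.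
Proof.
move=> hA; exists (spectralmx A), (fun i => complex.Re (spectral_diag A 0 i)).
split; first exact: spectral_unitarymx.
rewrite {1}(hermsymmx_spectralE hA) /udiag /diagc.
suff {1}-> : spectral_diag A = \row_i (complex.Re (spectral_diag A 0 i))%:C by [].
apply/rowP => i; rewrite mxE RRe_real//.
by have /mxOverP := hermitian_spectral_diag_real hA.
Qed.

Lemma char_poly_similar (M N P : 'M[R[i]]_m) : P \in unitmx ->
  M = invmx P *m N *m P -> char_poly M = char_poly N.
Proof.
move=> uP ->; rewrite /char_poly /char_poly_mx.
have uPX : map_mx polyC P \in unitmx by rewrite map_unitmx.
have -> : 'X%:M - map_mx polyC (invmx P *m N *m P) =
  invmx (map_mx polyC P) *m ('X%:M - map_mx polyC N) *m map_mx polyC P.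
  rewrite mulmxBr mulmxBl !map_mxM map_invmx; congr (_ - _).
  by rewrite -mulmxA -scalar_mxC mulmxA mulVmx ?mul1mx.
by rewrite !det_mulmx mulrC mulrA -det_mulmx mulmxV // det1 mul1r.
Qed.

Lemma char_poly_udiag U d : U \is unitarymx ->
  char_poly (udiag U d) = \prod_(i < m) ('X - ((d i)%:C)%:P).
Proof.
move=> uU; rewrite (@char_poly_similar _ (diagc d) U).
- rewrite char_poly_trig; last exact/diag_mx_is_trig.
  by apply: eq_bigr => i _; rewrite diagcE eqxx mulr1n.
- exact: unitarymx_unit.
- by rewrite invmx_unitary.
Qed.

(** [spectral_diag] and [d] both list, with multiplicity, the roots of one characteristic
    polynomial, hence agree up to a permutation; real parts are then taken. *)
Lemma perm_eigenvalues_udiag U d : U \is unitarymx ->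
  perm_eq (eigenvalues (udiag U d)) [seq d i | i <- enum 'I_m].
Proof.
move=> uU; rewrite /eigenvalues perm_sort.
set A := udiag U d; set s := spectral_diag A.
have spec : char_poly A = \prod_(i < m) ('X - (s 0 i)%:P).
  rewrite (@char_poly_similar _ (diag_mx s) (spectralmx A)).
  - rewrite char_poly_trig; last exact/diag_mx_is_trig.
    by apply: eq_bigr => i _; rewrite mxE eqxx mulr1n.
  - exact: spectral_unit.
  - rewrite (invmx_unitary (spectral_unitarymx _)).
    exact/hermsymmx_spectralE/udiag_herm.
have: perm_eq [seq s 0 i | i <- enum 'I_m] [seq (d i)%:C | i <- enum 'I_m].
  have prodE (F : 'I_m -> R[i]) :
      \prod_(x <- [seq F i | i <- enum 'I_m]) ('X - x%:P)
      = \prod_(i < m) ('X - (F i)%:P).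
    by rewrite big_map big_enum.
  by apply: prod_XsubC_eq; rewrite !prodE -spec char_poly_udiag.
by move=> /(perm_map (@complex.Re R)); rewrite -!map_comp.
Qed.

End UnitaryDiagonal.

(** * Positive definite matrices, their real powers, and the Riccati equation of the geometric
    mean *)

Section PositiveDefinite.
Variables (R : realType) (m : nat).
Implicit Types (A B P S T X Y U G : 'M[R[i]]_m) (d e : 'I_m -> R).

(** With v the adjoint of row i of [U], this entry becomes a value of the quadratic form in [pdmx]
    and [psdmx]. *)
Lemma mulmx_trmxC_entry (p q : nat) (U : 'M[R[i]]_(p, q)) (A : 'M[R[i]]_q) i :
  (U *m A *m U ^t*) i i = (row i U *m A *m (row i U)^t*) 0 0.
Proof.
rewrite -row_mul !mxE; apply: eq_bigr => j _.
by rewrite !mxE; congr (_ * _); rewrite !mxE.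
Qed.

Lemma row_unitary_neq0 U i : U \is unitarymx -> (row i U)^t* != 0.
Proof.
move=> /unitarymxP uU; apply/eqP => U0.
have := congr1 (fun M : 'M[R[i]]_m => M i i) uU.
rewrite -[U in U *m _]mulmx1 mulmx_trmxC_entry U0 mulmx0 !mxE eqxx.
by move/eqP; rewrite eq_sym oner_eq0.
Qed.

Lemma pdmx_diag_gt0 A U i : pdmx A -> U \is unitarymx ->
  0 < (U *m A *m U ^t*) i i.
Proof.
move=> [_ pA] uU; rewrite mulmx_trmxC_entry -{1}[row i U]trmxCK.
exact/pA/row_unitary_neq0.
Qed.

Lemma psdmx_diag_ge0 A U i : psdmx A -> 0 <= (U *m A *m U ^t*) i i.
Proof. by move=> [_ pA]; rewrite mulmx_trmxC_entry -{1}[row i U]trmxCK. Qed.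

Lemma udiag_conj U d : U \is unitarymx -> U *m udiag U d *m U ^t* = diagc d.
Proof.
move=> uU; have /unitarymxP UU := uU.
by rewrite /udiag !mulmxA UU mul1mx -mulmxA UU mulmx1.
Qed.

Lemma udiag_pd_gt0 U d : U \is unitarymx -> pdmx (udiag U d) ->
  forall i, 0 < d i.
Proof.
move=> uU pA i; have := pdmx_diag_gt0 i pA uU.
by rewrite udiag_conj// diagcE eqxx mulr1n ltcR.
Qed.

Lemma pdmx1 : pdmx (1%:M : 'M[R[i]]_m).
Proof.
split; first by apply/hermsymmxP; rewrite trmx1 map_mx1.
move=> v v0; rewrite mulmx1 -{2}[v]trmxCK -dotmxE; apply: dotmx_is_dotmx.
by apply: contraNneq v0 => v0; rewrite -[v]trmxCK v0 trmx0 map_mx0.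
Qed.

Lemma pdmx_congr A P : P \in unitmx -> pdmx A -> pdmx (P ^t* *m A *m P).
Proof.
move=> uP [/hermsymmxP hA pA]; split.
  by apply/hermsymmxP; rewrite !trmxC_mul trmxCK hA mulmxA.
move=> v v0.
have -> : v ^t* *m (P ^t* *m A *m P) *m v = (P *m v)^t* *m A *m (P *m v).
  by rewrite trmxC_mul !mulmxA.
apply: pA; apply: contraNneq v0 => Pv0.
by rewrite -[v]mul1mx -(mulVmx uP) -mulmxA Pv0 mulmx0.
Qed.

Lemma psdmx_congr A P : psdmx A -> psdmx (P ^t* *m A *m P).
Proof.
move=> [/hermsymmxP hA pA]; split.
  by apply/hermsymmxP; rewrite !trmxC_mul trmxCK hA mulmxA.
move=> v.
have -> : v ^t* *m (P ^t* *m A *m P) *m v = (P *m v)^t* *m A *m (P *m v).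
  by rewrite trmxC_mul !mulmxA.
exact: pA.
Qed.

Lemma diagc_unit d : (forall i, d i != 0) -> diagc d \in unitmx.
Proof.
move=> d0; rewrite unitmxE det_diag unitfE; apply/prodf_neq0 => i _.
by rewrite mxE fmorph_eq0.
Qed.

Lemma udiag_unit U d : U \is unitarymx -> (forall i, d i != 0) ->
  udiag U d \in unitmx.
Proof.
move=> uU d0; rewrite /udiag !unitmx_mul diagc_unit// (unitarymx_unit uU).
by rewrite (@unitarymx_unit _ _ (U ^t*)) ?trmxC_unitary.
Qed.

(** The matrix is the congruence of the identity by C = D^(1/2) U, which is invertible. *)
Lemma udiag_pd U d : U \is unitarymx -> (forall i, 0 < d i) -> pdmx (udiag U d).
Proof.
move=> uU d0.
set r := Num.sqrt \o d; pose C := diagc r *m U.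
have uC : C \in unitmx.
  rewrite /C unitmx_mul (unitarymx_unit uU) diagc_unit// => i.
  by rewrite gt_eqF// sqrtr_gt0.
suff -> : udiag U d = C ^t* *m 1%:M *m C by exact: pdmx_congr uC pdmx1.
have -> : d = (fun i => r i * r i).
  by apply/funext => i; rewrite -expr2 sqr_sqrtr// ltW.
by rewrite /C mulmx1 trmxC_mul trmxC_diagc /udiag -diagcM !mulmxA.
Qed.

Lemma pdmx_udiag A : pdmx A ->
  exists U d, [/\ U \is unitarymx, forall i, 0 < d i & A = udiag U d].
Proof.
move=> pA; have [U [d [uU AE]]] := hermsymmx_udiag pA.1.
by exists U, d; split=> //; apply: (udiag_pd_gt0 uU); rewrite -AE.
Qed.

Lemma pdmx_unit A : pdmx A -> A \in unitmx.
Proof.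
move=> /pdmx_udiag[U [d [uU d0 ->]]].
by apply: udiag_unit => // i; rewrite gt_eqF.
Qed.

Lemma pdmx_trmxC A : pdmx A -> A ^t* = A.
Proof. by case=> /hermsymmxP. Qed.

Lemma mxpow_udiag U d p : U \is unitarymx ->
  mxpow (udiag U d) p = udiag U (fun i => d i `^ p).
Proof. by move=> uU; rewrite /mxpow mxfun_udiag. Qed.

Lemma mxpow_pd A p : pdmx A -> pdmx (mxpow A p).
Proof.
move=> /pdmx_udiag[U [d [uU d0 ->]]]; rewrite (mxpow_udiag _ _ uU).
by apply: udiag_pd => // i; rewrite powR_gt0.
Qed.

Lemma mxpowD A p q : pdmx A -> mxpow A p *m mxpow A q = mxpow A (p + q).
Proof.
move=> /pdmx_udiag[U [d [uU d0 ->]]]; rewrite !(mxpow_udiag _ _ uU) (udiagM _ _ uU).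
by apply: eq_udiag => i; rewrite powRD// (gt_eqF (d0 i)) implybT.
Qed.

Lemma mxpowM A p q : pdmx A -> mxpow (mxpow A p) q = mxpow A (p * q).
Proof.
move=> /pdmx_udiag[U [d [uU d0 ->]]]; rewrite !(mxpow_udiag _ _ uU).
by apply: eq_udiag => i; rewrite powRrM.
Qed.

Lemma mxpow0 A : pdmx A -> mxpow A 0 = 1%:M.
Proof.
move=> /pdmx_udiag[U [d [uU d0 ->]]]; rewrite (mxpow_udiag _ _ uU) -(udiag1 uU).
by apply: eq_udiag => i; rewrite powRr0.
Qed.

Lemma mxpow1 A : pdmx A -> mxpow A 1 = A.
Proof.
move=> /pdmx_udiag[U [d [uU d0 ->]]]; rewrite (mxpow_udiag _ _ uU).
by apply: eq_udiag => i; rewrite powRr1// ltW.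
Qed.

Lemma mxpow_mulV A p : pdmx A -> mxpow A p *m mxpow A (- p) = 1%:M.
Proof. by move=> pA; rewrite mxpowD// subrr mxpow0. Qed.

Lemma mxpow_Vmul A p : pdmx A -> mxpow A (- p) *m mxpow A p = 1%:M.
Proof. by move=> pA; rewrite mxpowD// addNr mxpow0. Qed.

Lemma mxpow_half_sqr A : pdmx A -> mxpow A 2^-1 *m mxpow A 2^-1 = A.
Proof.
by move=> pA; rewrite mxpowD// -[2^-1]div1r -splitr mxpow1.
Qed.

Lemma pdmx_conj A P : pdmx A -> pdmx P -> pdmx (P *m A *m P).
Proof.
move=> pA pP; rewrite -{1}(pdmx_trmxC pP).
by apply: pdmx_congr pA; apply: pdmx_unit.
Qed.

Lemma gmean_pd A B : pdmx A -> pdmx B -> pdmx (gmean A B).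
Proof.
move=> pA pB; apply: (pdmx_conj _ (mxpow_pd _ pA)).
by apply: mxpow_pd; apply: (pdmx_conj pB (mxpow_pd _ pA)).
Qed.

(** The middle product A^(1/2) A^(-1) A^(1/2) collapses to the identity, so the two copies of Z =
    (A^(-1/2) B A^(-1/2))^(1/2) meet and multiply to A^(-1/2) B A^(-1/2). *)
Lemma gmean_riccati A B : pdmx A -> pdmx B ->
  gmean A B *m mxpow A (-1) *m gmean A B = B.
Proof.
move=> pA pB; rewrite /gmean.
set S := mxpow A 2^-1; set T := mxpow A (- 2^-1); set Z := mxpow _ 2^-1.
have ST : S *m T = 1%:M by exact: mxpow_mulV.
have TS : T *m S = 1%:M by exact: mxpow_Vmul.
have ZZ : Z *m Z = T *m B *m T.
  exact: mxpow_half_sqr (pdmx_conj pB (mxpow_pd _ pA)).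
have -> : mxpow A (-1) = T *m T.
  have halves : - 2^-1 + - 2^-1 = -1 :> R by rewrite -opprD -div1r -splitr.
  by rewrite (mxpowD _ _ pA) halves.
move: S T Z ST TS ZZ => S T Z ST TS ZZ.
have -> : S *m Z *m S *m (T *m T) *m (S *m Z *m S)
  = S *m (Z *m (S *m T *m (T *m S)) *m Z) *m S by rewrite !mulmxA.
rewrite ST TS !mulmx1 ZZ !mulmxA ST mul1mx.
by rewrite -mulmxA TS mulmx1.
Qed.

End PositiveDefinite.

(** * Rigidity: equality in the Loewner order, and commutation from normality *)

Section Rigidity.
Variables (R : realType) (m : nat).
Implicit Types (A B P S T X Y U G : 'M[R[i]]_m) (d e : 'I_m -> R).

(** The factors other than the i-th multiply to at least 1, so 1 + d_i is at most the whole
    product. *)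
Lemma prod_1D_eq1 d : (forall i, 0 <= d i) -> \prod_i (1 + d i) = 1 ->
  forall i, d i = 0.
Proof.
move=> d0 prod1 i; apply/eqP; rewrite eq_le d0 andbT.
rewrite -(lerD2l 1) addr0 -[leRHS]prod1 (bigD1 i)//= ler_peMr ?addr_ge0//.
elim/big_ind: _ => [//|x y x1 y1|j _]; last by rewrite lerDl.
by rewrite -[1]mulr1 ler_pM.
Qed.

(** Conjugation by X^(-1/2) turns X into the identity and Y into 1 + K with K positive semidefinite.
    Equal determinants make the product of the 1 + k_i equal to 1, so all eigenvalues k_i of K
    vanish. *)
Lemma loewner_le_det_eq X Y : pdmx X -> loewner_le X Y ->
  \det X = \det Y -> X = Y.
Proof.
move=> pX leXY detXY.
have := mxpow_half_sqr pX.
have := mxpow_mulV 2^-1 pX; have := mxpow_Vmul 2^-1 pX.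
have := mxpow_pd (- 2^-1) pX.
move: (mxpow X 2^-1) (mxpow X (- 2^-1)) => S T pT TS ST SS.
have TXT : T *m X *m T = 1%:M by rewrite -SS mulmxA TS mul1mx ST.
have psdK : psdmx (T *m (Y - X) *m T).
  by have := psdmx_congr T leXY; rewrite (pdmx_trmxC pT).
have [U [k [uU KE]]] := hermsymmx_udiag psdK.1.
have k0 i : 0 <= k i.
  have := psdmx_diag_ge0 U i psdK.
  by rewrite KE (udiag_conj _ uU) diagcE eqxx mulr1n ler0c.
have TYT : T *m Y *m T = udiag U (fun i => 1 + k i).
  rewrite -udiagD (udiag1 uU) -KE -TXT.
  by rewrite mulmxBr mulmxBl addrC subrK.
have kE : forall i, k i = 0.
  apply: prod_1D_eq1 => //; apply: (@complexI R).
  rewrite -(det_udiag _ uU) -TYT !det_mulmx -detXY -!det_mulmx TXT.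
  by rewrite det1 rmorph1.
have K0 : T *m (Y - X) *m T = 0.
  rewrite KE /udiag; have -> : diagc k = 0 :> 'M[R[i]]_m.
    by apply/matrixP => i j; rewrite diagcE kE mxE mul0rn.
  by rewrite mulmx0 mul0mx.
have : S *m (T *m (Y - X) *m T) *m S = 0 by rewrite K0 mulmx0 mul0mx.
rewrite !mulmxA ST mul1mx -mulmxA TS mulmx1 => /eqP.
by rewrite subr_eq0 => /eqP.
Qed.

Lemma pdmx_det_gt0 A : pdmx A -> 0 < \det A.
Proof.
move=> /pdmx_udiag[U [d [uU d0 ->]]]; rewrite (det_udiag _ uU) ltcR.
exact: prodr_gt0.
Qed.

(* Here [G *m A] is normal, and its eigenvalues are real since it is similar
   to a Hermitian matrix; hence it is Hermitian. *)
Lemma pdmx_comm_of_normal A G : pdmx A -> pdmx G ->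
  G *m (A *m A) *m G = A *m (G *m G) *m A -> A *m G = G *m A.
Proof.
move=> pA pG eqAG; pose M := G *m A.
have hA := pdmx_trmxC pA; have hG := pdmx_trmxC pG.
have MtE : M ^t* = A *m G by rewrite trmxC_mul hA hG.
have nM : M \is normalmx.
  by apply/normalmxP; rewrite MtE /M; move: eqAG; rewrite !mulmxA.
have uV : spectralmx M \is unitarymx := spectral_unitarymx M.
have := orthomx_spectralP nM; rewrite (invmx_unitary uV).
move: (spectralmx M) (spectral_diag M) uV => V s uV ME.
have /unitarymxP VV := uV.
have sR i : Num.conj (s 0 i) = s 0 i.
  have pos1 := pdmx_diag_gt0 i (pdmx_conj pA pG) uV.
  have pos2 := pdmx_diag_gt0 i pG uV.
  (* Since M G = G A G, comparing diagonal entries in the eigenbasis of [M] exhibits s_i as a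
     quotient of two positive numbers. *)
  have sE : s 0 i * (V *m G *m V ^t*) i i = (V *m (G *m A *m G) *m V ^t*) i i.
    rewrite -[G *m A]/M ME !mulmxA VV mul1mx -!mulmxA mul_diag_mx mxE.
    by rewrite !mulmxA.
  suff s0 : 0 < s 0 i by exact/conj_Creal/gtr0_real.
  rewrite -sE in pos1; move: pos1 pos2.
  by move: ((V *m G *m V ^t*) i i) (s 0 i) => x y yx_gt0 /pmulr_lgt0 <-.
have Ds : (diag_mx s)^t* = diag_mx s.
  apply/matrixP => i j; rewrite !mxE eq_sym.
  by case: eqP => [->|_]; rewrite ?mulr1n ?sR // mulr0n conjC0.
by rewrite -MtE -/M ME !trmxC_mul trmxCK Ds mulmxA.
Qed.

End Rigidity.

(** * Commutation of A and B, and their simultaneous diagonalization *)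

Section Commutation.
Variables (R : realType) (m : nat).
Implicit Types (A B P S T X Y U G : 'M[R[i]]_m) (d e : 'I_m -> R).

Lemma gmean_mxpowN_riccati A Y p : pdmx A -> pdmx Y ->
  gmean (mxpow A (- p)) Y *m mxpow A p *m gmean (mxpow A (- p)) Y = Y.
Proof.
move=> pA pY; have := gmean_riccati (mxpow_pd (- p) pA) pY.
by rewrite (mxpowM _ _ pA) mulrN1 opprK.
Qed.

Lemma mulmx_cancel2 G X Y : G \in unitmx ->
  G *m X *m G = G *m Y *m G -> X = Y.
Proof.
move=> uG /(congr1 (mulmx (invmx G))); rewrite !mulmxA mulVmx// !mul1mx.
by move=> /(congr1 (fun M => M *m invmx G)); rewrite !mulmxK.
Qed.

(** After cancelling det A, the squares of two positive determinants coincide. *)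
Lemma det_riccati_eq A G H : pdmx A -> pdmx G -> pdmx H ->
  \det (G *m A *m G) = \det (H *m A *m H) -> \det G = \det H.
Proof.
move=> /pdmx_det_gt0 A0 /pdmx_det_gt0 G0 /pdmx_det_gt0 H0.
rewrite !det_mulmx !(mulrAC _ (\det A)) => /(mulIf (lt0r_neq0 A0)).
rewrite -!expr2 => /eqP; rewrite eqrXn2 ?ltW// => /eqP.
by [].
Qed.

(* Both sides of the order relation have determinant [det b / det a]: the
   relation is an equality. *)
Lemma riccati_le_comm (a b G H : 'M[R[i]]_m) :
  pdmx a -> pdmx G -> pdmx H ->
  G *m a *m G = b -> H *m (a *m a) *m H = b *m b ->
  loewner_le (G *m G) H -> a *m b = b *m a.
Proof.
move=> pa pG pH Gric Hric leGH.
have pGG : pdmx (G *m G).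
  by have := pdmx_conj (pdmx1 R m) pG; rewrite mulmx1.
have paa : pdmx (a *m a).
  by have := pdmx_conj (pdmx1 R m) pa; rewrite mulmx1.
(* Both sides equal (det b)^2: at the level of determinants, G^2 solves the Riccati equation of
   H. *)
have detE : \det (G *m G *m (a *m a) *m (G *m G)) = \det (H *m (a *m a) *m H).
  by rewrite Hric -Gric !det_mulmx; ring.
have GGH : G *m G = H.
  by apply: (loewner_le_det_eq pGG leGH); apply: det_riccati_eq paa pGG pH detE.
have comm : a *m G = G *m a.
  (* With b = G a G and H = G^2, the equation H a^2 H = b^2 has an outer factor G on each side;
     cancelling it leaves G a^2 G = a G^2 a. *)
  apply: pdmx_comm_of_normal => //; apply: (mulmx_cancel2 (pdmx_unit pG)).
  by move: Hric; rewrite -Gric -GGH !mulmxA => ->.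
by rewrite -Gric !mulmxA comm -(mulmxA (G *m a)) comm !mulmxA.
Qed.

(** The exponent [2^-1^-1] is 2, so the order relation compares G^2 with H. Commutation of the
    square roots a and b then passes to A = a^2 and B = b^2. *)
Lemma riccati_power_le_comm A B G H : pdmx A -> pdmx B -> pdmx G -> pdmx H ->
  G *m mxpow A 2^-1 *m G = mxpow B 2^-1 ->
  H *m mxpow A 1 *m H = mxpow B 1 ->
  loewner_le (mxpow G 2^-1^-1) (mxpow H 1^-1) -> A *m B = B *m A.
Proof.
move=> pA pB pG pH Gric; rewrite invr1 (mxpow1 pH) (mxpow1 pA) (mxpow1 pB).
rewrite invrK -[2]/(1 + 1) -(mxpowD _ _ pG) (mxpow1 pG).
move: Gric (mxpow_pd 2^-1 pA) (mxpow_half_sqr pA) (mxpow_half_sqr pB).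
move: (mxpow A 2^-1) (mxpow B 2^-1) => a b Gric pa <- <- Hric.
move=> /(riccati_le_comm pa pG pH Gric Hric) ab.
by rewrite !mulmxA -(mulmxA a a b) ab mulmxA ab -!mulmxA ab (mulmxA a b) ab !mulmxA.
Qed.

Lemma gmean_power_le_comm A B : pdmx A -> pdmx B ->
  loewner_le (mxpow (gmean (mxpow A (- 2^-1)) (mxpow B 2^-1)) 2^-1^-1)
             (mxpow (gmean (mxpow A (- 1)) (mxpow B 1)) 1^-1) ->
  A *m B = B *m A.
Proof.
move=> pA pB.
have pb := mxpow_pd 2^-1 pB; have pB1 := mxpow_pd 1 pB.
exact: (riccati_power_le_comm pA pB
  (gmean_pd (mxpow_pd (- 2^-1) pA) pb) (gmean_pd (mxpow_pd (- 1) pA) pB1)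
  (gmean_mxpowN_riccati 2^-1 pA pb) (gmean_mxpowN_riccati 1 pA pB1)).
Qed.

(** Commutation makes N = A + iB normal. In a unitary eigenbasis of N, the real and imaginary parts
    of its eigenvalues are the eigenvalues of A and B. *)
Lemma hermsymmx_codiag A B : A \is hermsymmx -> B \is hermsymmx ->
  A *m B = B *m A ->
  exists U d e, [/\ U \is unitarymx, A = udiag U d & B = udiag U e].
Proof.
move=> hA hB AB; pose N := A + 'i *: B.
have /hermsymmxP At := hA; have /hermsymmxP Bt := hB.
have adjD P S : P ^t* = P -> S ^t* = S -> (P + 'i *: S)^t* = P - 'i *: S.
  move=> hP hS; apply/matrixP => i j.
  rewrite -{2}hP -{2}hS !mxE rmorphD rmorphM/=; congr (_ + _).
  by rewrite conjCi mulNr.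
have nN : N \is normalmx.
  have : A *m ('i *: B) = 'i *: B *m A by rewrite -scalemxAr -scalemxAl AB.
  move=> AX; apply/normalmxP; rewrite adjD// /N; move: ('i *: B) AX => X AX.
  by rewrite mulmxDl mulmxBl !mulmxDr !mulmxN AX opprD !addrA subrK addrK.
have uV : spectralmx N \is unitarymx := spectral_unitarymx N.
have := orthomx_spectralP nN; rewrite (invmx_unitary uV).
move: (spectralmx N) (spectral_diag N) uV => V s uV NE.
exists V, (fun i => complex.Re (s 0 i)), (fun i => complex.Im (s 0 i)).
set P := udiag _ _; set Q := udiag _ _.
have NPQ : A + 'i *: B = P + 'i *: Q.
  have sE : diag_mx s = diagc (fun i => complex.Re (s 0 i))
                        + 'i *: diagc (fun i => complex.Im (s 0 i)).
    apply/matrixP => i j; rewrite [RHS]mxE [X in _ + X]mxE !diagcE mxE.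
    by rewrite mulrnAr -mulrnDl {1}[s 0 i]complexE complexiE; case: eqP => [->|].
  by rewrite -/N NE sE mulmxDr mulmxDl -scalemxAr -scalemxAl.
(* The adjoint of the previous equality; adding the two isolates [A]. *)
have NtPQ : A - 'i *: B = P - 'i *: Q.
  by rewrite -(adjD _ _ At Bt) NPQ; apply: adjD; exact: trmxC_udiag.
have AP : A = P.
  apply: (@scalerI _ _ 2); first by rewrite pnatr_eq0.
  rewrite !scaler_nat !mulr2n.
  have := congr2 +%R NPQ NtPQ.
  by rewrite /= (addrACA A) (addrACA P) !subrr !addr0.
split; [exact: uV|exact: AP|]; move: NPQ; rewrite AP => /addrI.
by apply: scalerI; rewrite neq0Ci.
Qed.

End Commutation.

(** * Scalar weighted power means: monotonicity in the exponent and limit at 0 *)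

Section PowerMean.
Variable R : realType.
Implicit Types (t a b r s x y : R).

Definition power_mean t a b s : R :=
  ((1 - t) * a `^ s + t * b `^ s) `^ s^-1.

Lemma convex_comb_gt0 t x y : 0 <= t <= 1 -> 0 < x -> 0 < y ->
  0 < (1 - t) * x + t * y.
Proof.
move=> /andP[t0 t1] x0 y0; have [->|tn0] := eqVneq t 0.
  by rewrite subr0 mul1r mul0r addr0.
by rewrite ltr_wpDl ?mulr_ge0 ?subr_ge0 ?(ltW x0)// mulr_gt0// lt_def tn0.
Qed.

Lemma power_mean_gt0 t a b s : 0 <= t <= 1 -> 0 < a -> 0 < b ->
  0 < power_mean t a b s.
Proof. by move=> t01 a0 b0; rewrite powR_gt0// convex_comb_gt0// powR_gt0. Qed.

Lemma powR_convex_comb t x y r : 0 <= t <= 1 -> 0 < x -> 0 < y -> 1 <= r ->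
  ((1 - t) * x + t * y) `^ r <= (1 - t) * x `^ r + t * y `^ r.
Proof.
move=> /andP[t0 t1] x0 y0 r1.
rewrite addrC [leRHS]addrC; apply: (convex_powR r1 (Itv01 t0 t1)).
  by rewrite inE /= in_itv/= andbT ltW.
by rewrite inE /= in_itv/= andbT ltW.
Qed.

(** Convexity of the power s/r >= 1 is applied at the points a^r and b^r, then the increasing power
    1/s is taken. *)
Lemma power_mean_le t a b r s : 0 <= t <= 1 -> 0 < a -> 0 < b ->
  0 < r -> r <= s -> power_mean t a b r <= power_mean t a b s.
Proof.
move=> t01 a0 b0 r0 rs; have s0 := lt_le_trans r0 rs.
have rV : r^-1 = s / r * s^-1 by rewrite mulrAC divff ?mul1r// gt_eqF.
have sE : s = r * (s / r) by rewrite mulrCA divff ?mulr1// gt_eqF.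
rewrite /power_mean rV (powRrM _ (s / r)); apply: ge0_ler_powR.
- by rewrite invr_ge0 ltW.
- by rewrite nnegrE powR_ge0.
- by rewrite nnegrE ltW// convex_comb_gt0// powR_gt0.
rewrite {2 3}sE !(powRrM _ r); apply: powR_convex_comb; rewrite ?powR_gt0//.
by rewrite ler_pdivlMr// mul1r.
Qed.

(* The exponent of the limit is the derivative at [0] of
   [s |-> ln ((1 - t) a^s + t b^s)]. *)
Lemma power_mean_cvg t a b : 0 <= t <= 1 -> 0 < a -> 0 < b ->
  power_mean t a b s @[s --> 0^'+] --> expR ((1 - t) * ln a + t * ln b).
Proof.
move=> t01 a0 b0.
(* For positive a, the power a^s is [expR (s * ln a)], a form that can be differentiated at s =
   0. *)
pose g s := (1 - t) * expR (s * ln a) + t * expR (s * ln b).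
have g0 : g 0 = 1 by rewrite /g !mul0r expR0 !mulr1 subrK.
have expD c : is_derive (0 : R) 1 (fun s : R => expR (s * c)) c.
  have lD : is_derive (0 : R) 1 (fun s : R => s * c) c.
    have -> : (fun s : R => s * c) = c \*: id by apply/funext => s; rewrite /= mulrC.
    by have := is_deriveZ c (is_derive_id (0 : R) 1); rewrite /GRing.scale/= mulr1.
  have := @is_derive1_comp R expR (fun s => s * c) 0 (expR (0 * c)) c (is_derive_expR _) lD.
  by rewrite mul0r expR0 mul1r.
have gD : is_derive (0 : R) 1 g ((1 - t) * ln a + t * ln b).
  exact: is_deriveD (is_deriveZ (1 - t) (expD (ln a))) (is_deriveZ t (expD (ln b))).
have lnD : is_derive (0 : R) 1 (@ln R \o g) ((1 - t) * ln a + t * ln b).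
  have := @is_derive1_comp R (@ln R) g 0 _ _ (is_derive1_ln _) gD.
  by rewrite g0 invr1 mul1r; apply.
have [dv dvE] := lnD.
have : s^-1 *: (((@ln R \o g) \o shift 0) (s *: (1 : R)) - (@ln R \o g) 0)
    @[s --> 0^'] --> (1 - t) * ln a + t * ln b by rewrite -dvE; exact: dv.
move=> /cvg_dnbhs_at_right lim.
(* As g(0) = 1, the difference quotient is ln(g(s)) / s, whose exponential is the power mean for s >
   0. *)
have expLim := continuous_cvg _ (@continuous_expR R _) lim.
apply: (cvg_trans _ (expLim _)); apply: near_eq_cvg; near=> s.
have gs : (1 - t) * a `^ s + t * b `^ s = g s.
  by rewrite /g /powR !gt_eqF.
rewrite /= addr0 /GRing.scale/= mulr1 g0 ln1 subr0 /power_mean gs /powR.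
rewrite gt_eqF// -gs convex_comb_gt0// powR_gt0//.
Unshelve. all: by end_near.
Qed.

End PowerMean.

(** * Order statistics of dominated families, and limits of finite sums *)

(** Counting entries above the threshold [s1]_k[: if]s2[_k] were smaller, [s1] would have at least k
    + 1 such entries and [s2] at most k, whereas f <= g gives [s2] at least as many as [s1]. *)
Lemma sorted_perm_nth_le (R : realDomainType) (I : eqType) (r : seq I)
    (f g : I -> R) (s1 s2 : seq R) (k : nat) :
  (forall i, f i <= g i) ->
  sorted (fun x y : R => y <= x) s1 -> sorted (fun x y : R => y <= x) s2 ->
  perm_eq s1 [seq f i | i <- r] -> perm_eq s2 [seq g i | i <- r] ->
  (k < size r)%N -> s1`_k <= s2`_k.
Proof.
move=> fg st1 st2 p1 p2 kr; rewrite leNgt; apply/negP => s21.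
have geT : transitive (fun x y : R => y <= x).
  by move=> y x z yx zy; exact: le_trans zy yx.
have geR : reflexive (fun x y : R => y <= x) by move=> x; exact: lexx.
have sz1 : size s1 = size r by rewrite (perm_size p1) size_map.
have sz2 : size s2 = size r by rewrite (perm_size p2) size_map.
pose P : pred R := fun x => s1`_k <= x.
have le12 : (count P s1 <= count P s2)%N.
  rewrite (permP p1) (permP p2) !count_map; apply: sub_count => i /= Pfi.
  exact: le_trans Pfi (fg i).
have ge1 : (k < count P s1)%N.
  have all1 : all P (take k.+1 s1).
    apply/(all_nthP 0) => i; rewrite size_take_min sz1 leq_min => /andP[ik ir].
    rewrite nth_take//; apply: (sorted_leq_nth geT geR 0 st1) => //.
      by rewrite inE sz1.
    by rewrite inE sz1.
  rewrite -[s1 in count P s1](cat_take_drop k.+1) count_cat.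
  move: all1; rewrite all_count => /eqP ->.
  by rewrite size_take_min sz1 (minn_idPl kr) leq_addr.
have le2 : (count P s2 <= k)%N.
  have none2 : count P (drop k s2) = 0%N.
    apply/eqP; rewrite -leqn0 leqNgt -has_count; apply/negP => /(has_nthP 0)[n].
    rewrite size_drop sz2 => nr; rewrite nth_drop /P => Pn.
    have : s2`_(k + n) <= s2`_k.
      apply: (sorted_leq_nth geT geR 0 st2); rewrite ?inE ?sz2 ?leq_addr//.
      by rewrite -ltn_subRL.
    by move=> /(le_trans Pn); rewrite leNgt s21.
  rewrite -[s2](cat_take_drop k) count_cat none2 addn0.
  by apply: leq_trans (count_size _ _) _; rewrite size_take_min geq_minl.
by move: (leq_trans (leq_trans ge1 le12) le2); rewrite ltnn.
Qed.

(** This is the shape of an entry of [udiag U d]: linear in the diagonal, with coefficients fixed by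
    [U]. *)
Lemma cvg_bilinear_comb (K : numFieldType) (I T : Type) (F : set_system T)
    (FF : Filter F) (r : seq I) (c e l : I -> K) (f : T -> I -> K) :
  (forall k, f z k @[z --> F] --> l k) ->
  \sum_(k <- r) c k * f z k * e k @[z --> F] --> \sum_(k <- r) c k * l k * e k.
Proof.
move=> fl; elim: r => [|k r IH].
  by rewrite big_nil; under eq_fun do rewrite big_nil; exact: cvg_cst.
rewrite big_cons; under eq_fun do rewrite big_cons.
apply: cvgD IH; apply: cvgM; last exact: cvg_cst.
by apply: cvgM; [exact: cvg_cst|exact: fl].
Qed.

(** * Majorization, Wasserstein means and convergence in a common eigenbasis *)

Section Diagonal.
Variables (R : realType) (m : nat).
Implicit Types (U : 'M[R[i]]_m) (d e x y : 'I_m -> R).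

(** Entrywise domination survives sorting, and nonnegativity allows the inequalities to be
    multiplied. *)
Lemma wlogmaj_udiag U d e : U \is unitarymx ->
  (forall i, 0 <= d i) -> (forall i, d i <= e i) ->
  wlogmaj (udiag U d) (udiag U e).
Proof.
move=> uU d0 de k /andP[_ km]; apply: ler_prod => i _.
have pd := perm_eigenvalues_udiag d uU; have pe := perm_eigenvalues_udiag e uU.
have im : (i < m)%N by exact: leq_trans (ltn_ord i) km.
have geT : total (fun x y : R => y <= x) by move=> x y; exact: le_total.
apply/andP; split; last first.
  apply: (sorted_perm_nth_le de) pd pe _; rewrite ?size_enum_ord//; exact: sort_sorted.
have : (eigenvalues (udiag U d))`_i \in eigenvalues (udiag U d).
  by rewrite mem_nth// (perm_size pd) size_map size_enum_ord.
by rewrite (perm_mem pd) => /mapP[j _ ->].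
Qed.

Lemma powR_half_sqr (u : R) : 0 <= u -> (u ^+ 2) `^ 2^-1 = u.
Proof. by move=> u0; rewrite powR12_sqrt ?sqr_ge0// sqrtr_sqr ger0_norm. Qed.

Lemma mxpow_half_udiag_sqr U x : U \is unitarymx -> (forall i, 0 <= x i) ->
  mxpow (udiag U (fun i => x i ^+ 2)) 2^-1 = udiag U x.
Proof.
move=> uU x0; rewrite (mxpow_udiag _ _ uU); apply: eq_udiag => i.
exact: powR_half_sqr.
Qed.

Lemma mxpow_Nhalf_udiag_sqr U x : U \is unitarymx -> (forall i, 0 <= x i) ->
  mxpow (udiag U (fun i => x i ^+ 2)) (- 2^-1) = udiag U (fun i => (x i)^-1).
Proof.
move=> uU x0; rewrite (mxpow_udiag _ _ uU); apply: eq_udiag => i.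
by rewrite powRN powR_half_sqr.
Qed.

(** Writing the eigenvalues as squares removes the square roots and leaves rational identities. *)
Lemma gmean_udiag_sqr U x y : U \is unitarymx ->
  (forall i, 0 < x i) -> (forall i, 0 < y i) ->
  gmean (udiag U (fun i => x i ^+ 2)) (udiag U (fun i => y i ^+ 2))
  = udiag U (fun i => x i * y i).
Proof.
move=> uU x0 y0; rewrite /gmean.
rewrite (mxpow_half_udiag_sqr uU (fun i => ltW (x0 i))).
rewrite (mxpow_Nhalf_udiag_sqr uU (fun i => ltW (x0 i))) !(udiagM _ _ uU).
have -> : (fun i => (x i)^-1 * y i ^+ 2 * (x i)^-1) = (fun i => (y i / x i) ^+ 2).
  by apply/funext => i; ring.
rewrite mxpow_half_udiag_sqr// => [|i]; last by rewrite divr_ge0// ltW.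
rewrite !(udiagM _ _ uU); apply: eq_udiag => i.
by field; rewrite gt_eqF.
Qed.

(** The factor A^(-1) # B has eigenvalues y_i / x_i, so the cross term contributes 2t(1-t) x_i y_i
    and completes the square. *)
Lemma wmean_udiag_sqr (t : R) U x y : U \is unitarymx ->
  (forall i, 0 < x i) -> (forall i, 0 < y i) ->
  wmean t (udiag U (fun i => x i ^+ 2)) (udiag U (fun i => y i ^+ 2))
  = udiag U (fun i => ((1 - t) * x i + t * y i) ^+ 2).
Proof.
move=> uU x0 y0; rewrite /wmean.
have -> : invmx (udiag U (fun i => x i ^+ 2)) = udiag U (fun i => (x i)^-1 ^+ 2).
  rewrite (invmx_udiag uU) => [|i]; last by rewrite sqrf_eq0 gt_eqF.
  by apply: eq_udiag => i; rewrite exprVn.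
rewrite (gmean_udiag_sqr uU) => [|i|//]; last by rewrite invr_gt0.
rewrite !(udiagM _ _ uU) !udiagD !udiagZ !udiagD; apply: eq_udiag => i.
by field; rewrite gt_eqF.
Qed.

(** Take x_i = d_i^(p/2) and y_i = e_i^(p/2): raising the resulting square to the power 1/p gives
    the exponent 2/p of a power mean. *)
Lemma wmean_mxpow_udiag (t p : R) U d e : U \is unitarymx -> 0 <= t <= 1 ->
  (forall i, 0 < d i) -> (forall i, 0 < e i) ->
  mxpow (wmean t (mxpow (udiag U d) p) (mxpow (udiag U e) p)) p^-1
  = udiag U (fun i => power_mean t (d i) (e i) (p / 2)).
Proof.
move=> uU t01 d0 e0; rewrite !(mxpow_udiag _ _ uU).
have sqr c : (forall i : 'I_m, 0 < c i) ->
    (fun i => c i `^ p) = (fun i => (c i `^ (p / 2)) ^+ 2).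
  move=> c0; apply/funext => i.
  by rewrite -powR_mulrn ?powR_ge0// -powRrM divfK.
rewrite (sqr _ d0) (sqr _ e0) (wmean_udiag_sqr t uU) => [|i|i]; last 2 first.
- by rewrite powR_gt0.
- by rewrite powR_gt0.
rewrite (mxpow_udiag _ _ uU); apply: eq_udiag => i.
have w0 : 0 < (1 - t) * d i `^ (p / 2) + t * e i `^ (p / 2).
  by rewrite convex_comb_gt0// powR_gt0.
by rewrite /power_mean -powR_mulrn ?(ltW w0)// -powRrM invf_div.
Qed.

Lemma cvg_real_complex (T : Type) (F : set_system T) (FF : Filter F)
    (f : T -> R) (l : R) :
  f x @[x --> F] --> l -> (f x)%:C @[x --> F] --> (l%:C : R[i]).
Proof.
move=> /cvg_ballP fl; apply/cvg_ballP => -[e e'].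
(* A positive radius in [R[i]] has zero imaginary part, so it is a radius in [R]. *)
rewrite ltcE/= => /andP[/eqP-> e0]; apply: filterS (fl e e0) => x.
rewrite -!ball_normE => flx; suff : `|l%:C - (f x)%:C| < e%:C by [].
have -> : l%:C - (f x)%:C = (l - f x)%:C by rewrite rmorphB.
by rewrite normc_def/= expr0n addr0 sqrtr_sqr ltcR.
Qed.

(** Balls of matrices are entrywise, and finitely many neighbourhoods intersect in one. *)
Lemma cvg_mx_entry (T : Type) (F : set_system T) (FF : Filter F) (p q : nat)
    (f : T -> 'M[R[i]]_(p, q)) (L : 'M[R[i]]_(p, q)) :
  (forall i j, f x i j @[x --> F] --> L i j) -> f x @[x --> F] --> L.
Proof.
move=> fL; apply/cvg_ballP => e e0.
have : \forall x \near F, forall i j, ball (L i j) e (f x i j).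
  apply: filter_forall => i; apply: filter_forall => j.
  by have /cvg_ballP/(_ e e0) := fL i j.
by apply: filterS => x H; split.
Qed.

Lemma udiag_entry U d i j :
  udiag U d i j = \sum_k Num.conj (U k i) * (d k)%:C * U k j.
Proof.
rewrite /udiag /diagc mul_mx_diag mxE; apply: eq_bigr => k _.
by rewrite !mxE.
Qed.

Lemma cvg_udiag (T : Type) (F : set_system T) (FF : Filter F) U
    (f : T -> 'I_m -> R) d :
  (forall i, f x i @[x --> F] --> d i) -> udiag U (f x) @[x --> F] --> udiag U d.
Proof.
move=> fd; apply: cvg_mx_entry => i j; rewrite udiag_entry.
rewrite (funext (fun z => udiag_entry U (f z) i j)).
by apply: cvg_bilinear_comb => k; exact: cvg_real_complex.
Qed.

End Diagonal.

(** * Rescaling of the exponent, and the two claims *)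

Lemma at_right0_half (R : realType) : p / 2 @[p --> 0^'+] --> (0 : R)^'+.
Proof.
move=> S [e /= e0 He]; exists e => //= p pe p0; apply: He => /=; last first.
  by rewrite divr_gt0.
move: pe; rewrite /ball_/= !sub0r !normrN !gtr0_norm ?divr_gt0//.
by apply: le_lt_trans; rewrite ler_pdivrMr// mulr_natr mulr2n lerDl ltW.
Qed.

Theorem theorem5p6 (R : realType) (m : nat) (t : R) (A B : 'M[R[i]]_m)
  (ht : 0 <= t <= 1) (hA : pdmx A) (hB : pdmx B)
  (hAB : forall p q : R, 0 < p -> p <= q -> q <= 1 ->
     loewner_le
       (mxpow (gmean (mxpow A (- p)) (mxpow B p)) p^-1)
       (mxpow (gmean (mxpow A (- q)) (mxpow B q)) q^-1)) :
  (forall p q : R, 0 < p -> p <= q -> q <= 1 ->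
     wlogmaj
       (mxpow (wmean t (mxpow A p) (mxpow B p)) p^-1)
       (mxpow (wmean t (mxpow A q) (mxpow B q)) q^-1)) /\
  (mxpow (wmean t (mxpow A p) (mxpow B p)) p^-1 @[p --> 0^'+]
     --> mxexp ((1 - t)%:C *: mxlog A + t%:C *: mxlog B)).
Proof.
have half_gt0 : 0 < 2^-1 :> R by rewrite invr_gt0.
have half_le1 : 2^-1 <= 1 :> R by rewrite invf_le1 ?ler1n.
(* The hypothesis is taken at p = 1/2 and q = 1. *)
have comAB := gmean_power_le_comm hA hB (hAB _ _ half_gt0 half_le1 (lexx 1)).
have [U [d [e [uU AE BE]]]] := hermsymmx_codiag hA.1 hB.1 comAB.
have d0 : forall i, 0 < d i by apply: (udiag_pd_gt0 uU); rewrite -AE.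
have e0 : forall i, 0 < e i by apply: (udiag_pd_gt0 uU); rewrite -BE.
(* The identity holds for every real p, so it can also be rewritten under the limit. *)
have wE p : mxpow (wmean t (mxpow A p) (mxpow B p)) p^-1
    = udiag U (fun i => power_mean t (d i) (e i) (p / 2)).
  by rewrite AE BE; exact: wmean_mxpow_udiag.
split=> [p q p0 pq q1|].
  rewrite [X in wlogmaj X _](wE p) [X in wlogmaj _ X](wE q).
  apply: (wlogmaj_udiag uU) => i.
    by rewrite ltW// power_mean_gt0.
  by rewrite power_mean_le// ?divr_gt0// ler_pM2r ?invr_gt0.
rewrite (funext wE) AE BE.
(* The limit is diagonal in the same basis, with eigenvalues exp((1-t) ln d_i + t ln e_i), which
   reduces the claim to scalar power means. *)
rewrite /mxlog !(mxfun_udiag _ _ uU) !udiagZ udiagD /mxexp (mxfun_udiag _ _ uU).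
apply: cvg_udiag => i.
exact: cvg_comp (@at_right0_half R) (power_mean_cvg ht (d0 i) (e0 i)).
Qed.
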